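(* Let $\mathfrak{g}$ be a $6$-dimensional (non-Kähler, i.e. not admitting Kähler structures) strongly unimodular almost nilpotent real Lie algebra with nilradical $\mathfrak{n}$ satisfying $\dim\mathfrak{n}^1=1$, where $\mathfrak{n}^1=[\mathfrak{n},\mathfrak{n}]$. Then $\mathfrak{g}$ does not admit generalized Kähler structures $(J_+,J_-,g)$ such that $J_+(\mathfrak{n}^1)\subset\mathfrak{n}$ and $[\mathfrak{k}_3,\mathfrak{k}_3]\neq\{0\}$.
   Context: The nilradical $\mathfrak{n}$ of a solvable Lie algebra $\mathfrak{g}$ is its maximal nilpotent ideal; $\mathfrak{g}$ is almost nilpotent if it is solvable and $\mathfrak{n}$ has codimension one. With $\mathfrak{n}^0=\mathfrak{n}$, $\mathfrak{n}^{l}=[\mathfrak{n},\mathfrak{n}^{l-1}]$, a solvable $\mathfrak{g}$ is strongly unimodular if $\operatorname{tr}(\mathrm{ad}_X|_{\mathfrak{n}^l/\mathfrak{n}^{l+1}})=0$ for all $X\in\mathfrak{g}$, $l\in\mathbb{N}$. A generalized Kähler structure on $\mathfrak{g}$ is a triple $(J_+,J_-,g)$ where $J_\pm$ are integrable complex structures on $\mathfrak{g}$ and $g$ is a positive definite inner product orthogonal with respect to both, such that $dd^c_\pm\omega_\pm=0$ and $d^c_+\omega_++d^c_-\omega_-=0$, where $\omega_\pm=g(J_\pm\cdot,\cdot)$, $d$ is the Chevalley–Eilenberg differential and $d^c_\pm=i(\overline\partial_\pm-\partial_\pm)$ with respect to $J_\pm$. A Kähler structure is a Hermitian structure $(J,g)$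 with $d\omega=0$. When $J_+\mathfrak{n}^1\subset\mathfrak{n}$, $\mathfrak{k}_3$ is determined by $(J_+,g)$: $\mathfrak{k}_2=(\mathfrak{n}^1)^{\perp_g}\cap\mathfrak{n}$, $\mathfrak{k}_3=\mathfrak{k}_2\cap J_+\mathfrak{k}_2$ (two-dimensional here). *)

(* Defs.v *)
From HB Require Import structures.
From mathcomp Require Import all_boot all_order all_algebra.
From mathcomp Require Import complex reals.

Set Implicit Arguments.
Unset Strict Implicit.
Unset Printing Implicit Defensive.

Import Order.TTheory GRing.Theory Num.Theory.

Local Open Scope ring_scope.
Local Open Scope complex_scope.

Section LieAlgebra.
Variables (R : realType) (V : vectType R) (br : {bilinear V -> V -> V}).

Definition is_lie_bracket : Prop :=
  (forall x, br x x = 0) /\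
  (forall x y z, br x (br y z) + br y (br z x) + br z (br x y) = 0).

(* [U, W], the span of all brackets; by bilinearity bases are enough, see
   lie_prod_subP. *)
Definition lie_prod (U W : {vspace V}) : {vspace V} :=
  <<[seq br u w | u <- vbasis U, w <- vbasis W]>>%VS.

Lemma mem_lie_prod (U W : {vspace V}) u w :
  u \in U -> w \in W -> br u w \in lie_prod U W.
Proof.
move=> /coord_vbasis -> /coord_vbasis ->.
rewrite linear_sumlz; apply: memv_suml => i _.
rewrite linear_sumr; apply: memv_suml => j _.
rewrite linearZl_LR linearZr_LR /= !memvZ // memv_span //.
by apply: allpairs_f; apply: mem_nth; rewrite size_tuple.
Qed.

Lemma lie_prod_subP (U W X : {vspace V}) :
  reflect (forall u w, u \in U -> w \in W -> br u w \in X)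
          (lie_prod U W <= X)%VS.
Proof.
apply: (iffP idP) => [/subvP sX u w uU wW|sX].
  by apply: sX; apply: mem_lie_prod.
apply/span_subvP => _ /allpairsP[[u w] [/= ub wb ->]].
by apply: sX; apply: vbasis_mem.
Qed.

Definition is_ideal (I : {vspace V}) : Prop := (lie_prod fullv I <= I)%VS.

(* lcs U l is U^l: U^0 = U and U^(l+1) = [U, U^l]. *)
Definition lcs (U : {vspace V}) (l : nat) : {vspace V} :=
  iter l (lie_prod U) U.

Definition is_nilpotent (U : {vspace V}) : Prop := exists l, lcs U l = 0%VS.

Definition derived_series (l : nat) : {vspace V} :=
  iter l (fun U => lie_prod U U) fullv.

Definition is_solvable : Prop := exists l, derived_series l = 0%VS.

Definition is_nilradical (n : {vspace V}) : Prop :=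
  [/\ is_ideal n, is_nilpotent n &
      forall m : {vspace V},
        is_ideal m -> is_nilpotent m -> (n <= m)%VS -> m = n].

Definition almost_nilpotent (n : {vspace V}) : Prop :=
  [/\ is_solvable, is_nilradical n & (\dim n).+1 = \dim {:V}].

(* Trace of the endomorphism induced by f on U / W, for f-stable W <= U. The
   quotient is realized on the complement U :\: W of W in U; addv_pi1 U W is
   the projection of U onto U :\: W along W. *)
Definition quot_trace (U W : {vspace V}) (f : V -> V) : R :=
  \sum_(i < \dim (U :\: W)%VS)
    coord (vbasis (U :\: W)%VS) i
          (addv_pi1 U W (f (vbasis (U :\: W)%VS)`_i)).

Definition strongly_unimodular (n : {vspace V}) : Prop :=
  forall (x : V) (l : nat), quot_trace (lcs n l) (lcs n l.+1) (br x) = 0.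

End LieAlgebra.

(* Complex-valued cochains, that is, elements of Lambda^k g^* (x) C once they
   are R-multilinear and alternating. *)
Notation cform R V k := ({ffun 'I_k -> V} -> R[i]).

Section Forms.
Variables (R : realType) (V : vectType R) (br : {bilinear V -> V -> V}).

(* Chevalley-Eilenberg differential (trivial coefficients):
     (d a)(x_0, ..., x_(k+1)) =
       \sum_(i < j) (-1)^(i+j) a([x_i, x_j], x_0, ..^i..^j.., x_(k+1)).
   For i < j the ordinal lift j i has value i, and m |-> lift j (lift i m)
   enumerates the indices other than i and j in increasing order. *)
Definition ce_d (k : nat) (a : cform R V k.+1) : cform R V k.+2 :=
  fun x => \sum_(j < k.+2) \sum_(i < k.+1 | (i < j)%N)
    (-1) ^+ (i + j) *
    a [ffun m => if unlift ord0 m is Some m' then x (lift j (lift i m'))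
                 else br (x (lift j i)) (x j)].

Variable J : 'End(V).

(* Component of type (p, k - p). The C-multilinear extension of a is evaluated
   at the projections x^{1,0} = (x - i J x) / 2 for the slots in S and
   x^{0,1} = (x + i J x) / 2 for the others, with #|S| = p; the products are
   expanded, T being the set of slots in which the J-term is selected. *)
Definition type_part (k p : nat) (a : cform R V k) : cform R V k :=
  fun x => \sum_(S : {set 'I_k} | #|S| == p)
    (2 ^+ k)^-1 * \sum_(T : {set 'I_k})
      (\prod_(j in T) (if j \in S then - 'i%C else 'i%C)) *
      a [ffun j => if j \in T then J (x j) else x j].

(* On type (p, k + 1 - p), del is the (p + 1, k + 1 - p)-component of d and
   delbar the (p, k + 2 - p)-component. *)
Definition del (k : nat) (a : cform R V k.+1) : cform R V k.+2 :=
  fun x => \sum_(p < k.+2) type_part p.+1 (ce_d (type_part p a)) x.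

Definition delbar (k : nat) (a : cform R V k.+1) : cform R V k.+2 :=
  fun x => \sum_(p < k.+2) type_part p (ce_d (type_part p a)) x.

Definition dc (k : nat) (a : cform R V k.+1) : cform R V k.+2 :=
  fun x => 'i%C * (delbar a x - del a x).

Definition integrable_complex_structure : Prop :=
  (forall x, J (J x) = - x) /\
  (forall x y, br x y + J (br (J x) y + br x (J y)) - br (J x) (J y) = 0).

Variable g : {dot V for idfun}.

Definition hermitian_structure : Prop :=
  integrable_complex_structure /\ (forall x y, g (J x) (J y) = g x y).

Definition fundamental_form : cform R V 2 :=
  fun x => (g (J (x ord0)) (x ord_max))%:C.

Definition kahler_structure : Prop :=
  hermitian_structure /\ (forall x, ce_d fundamental_form x = 0).

End Forms.

Section GeneralizedKahler.
Variables (R : realType) (V : vectType R) (br : {bilinear V -> V -> V}).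

Definition generalized_kahler_structure
    (Jp Jm : 'End(V)) (g : {dot V for idfun}) : Prop :=
  [/\ hermitian_structure br Jp g,
      hermitian_structure br Jm g,
      (forall x, ce_d br (dc br Jp (fundamental_form Jp g)) x = 0),
      (forall x, ce_d br (dc br Jm (fundamental_form Jm g)) x = 0) &
      forall x, dc br Jp (fundamental_form Jp g) x
                + dc br Jm (fundamental_form Jm g) x = 0].

Definition k2 (n : {vspace V}) (g : {dot V for idfun}) : {vspace V} :=
  (orthov g (lcs br n 1) :&: n)%VS.

Definition k3 (n : {vspace V}) (J : 'End(V)) (g : {dot V for idfun}) :
    {vspace V} :=
  (k2 n g :&: (J @: k2 n g))%VS.

End GeneralizedKahler.

(* Main.v *)
(** Write [H_J(x,y,z)] for the cyclic sum of [g([Jx,Jy],z)]; for a Hermitian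
    structure this is [d^c omega].  Integrability makes the form
    [g([x,y],z) - g([y,z],x) + g([z,x],y) - H_J(x,y,z)] (twice the Bismut
    connection [g(nabla_x y, z)]) J-invariant in [(y,z)].  On a generalized
    Kaehler algebra [H_I = - H_J] for [I = J_-], so the same expression with
    [+ H_J] is I-invariant; nothing else about [I] is needed, apart from its
    being an orthogonal complex structure.

    Choose a unit [e1] in [n^1], [e3] in [k_3] and [e6] orthogonal to [n], and
    put [e2 = J e1], [e4 = J e3], [e5 = J e6].  Strong unimodularity makes [e1]
    central, and integrability of [J] leaves an explicit table of brackets with
    [[e3,e4] = c e1], [c <> 0].  The Jacobi identity and [d H_J = 0] leave two
    cases.  If the parameters [q] and [p + b] vanish, the I-invariance forces
    [I] to preserve a line.  Otherwise [I e1 = +- e2], and the I-invariance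
    gives scalar identities incompatible with [d H_J = 0]. *)

Require Import Defs.
From mathcomp Require Import all_boot all_order all_algebra.
From mathcomp Require Import complex reals.
From mathcomp Require Import boolp ring lra.

Set Implicit Arguments.
Unset Strict Implicit.
Unset Printing Implicit Defensive.

Import Order.TTheory GRing.Theory Num.Theory.

Local Open Scope ring_scope.
Local Open Scope complex_scope.

(** * Two- and three-forms *)

(** Subsets are coded by their membership bits, so that the sums over subsets in [type_part] become
    finite sums over booleans that can be expanded. *)
Lemma big_set2 (W : nmodType) (F : {set 'I_2} -> W) :
  \sum_(S : {set 'I_2}) F S =
  \sum_(b0 : bool) \sum_(b1 : bool)
    F [set i : 'I_2 | nth false [:: b0; b1] i].
Proof.
pose h (b : bool * bool) := [set i : 'I_2 | nth false [:: b.1; b.2] i].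
rewrite pair_big (reindex h) /=; first by apply: eq_bigr => -[].
exists (fun S : {set 'I_2} => (ord0 \in S, ord_max \in S)) => [[b0 b1] _|S _].
  by rewrite !inE.
by apply/setP => -[[|[|//]] lti]; rewrite inE /=; congr (_ \in S);
  apply: val_inj.
Qed.

Lemma big_set3 (W : nmodType) (F : {set 'I_3} -> W) :
  \sum_(S : {set 'I_3}) F S =
  \sum_(b0 : bool) \sum_(b1 : bool) \sum_(b2 : bool)
    F [set i : 'I_3 | nth false [:: b0; b1; b2] i].
Proof.
pose h (b : bool * (bool * bool)) :=
  [set i : 'I_3 | nth false [:: b.1; b.2.1; b.2.2] i].
transitivity (\sum_(b0 : bool) \sum_(b : bool * bool) F (h (b0, b)));
  last first.
  under [RHS]eq_bigr do rewrite pair_big /=.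
  by apply: eq_bigr => ? _; apply: eq_bigr => -[].
rewrite pair_big (reindex h) /=; first by apply: eq_bigr => -[? []].
exists (fun S : {set 'I_3} => (ord0 \in S, (inord 1 \in S, ord_max \in S)))
  => [[b0 [b1 b2]] _|S _].
  by rewrite !inE inordK.
apply/setP => -[[|[|[|//]]] lti]; rewrite inE /=; congr (_ \in S);
  by apply: val_inj; rewrite //= inordK.
Qed.

Section Forms.
Variables (R : realType) (V : vectType R).

Definition args2 (x y : V) : {ffun 'I_2 -> V} :=
  [ffun i : 'I_2 => nth 0 [:: x; y] i].
Definition args3 (x y z : V) : {ffun 'I_3 -> V} :=
  [ffun i : 'I_3 => nth 0 [:: x; y; z] i].

Definition args4 (w x y z : V) : {ffun 'I_4 -> V} :=
  [ffun i : 'I_4 => nth 0 [:: w; x; y; z] i].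

Lemma card_set2 (b0 b1 : bool) :
  #|[set i : 'I_2 | nth false [:: b0; b1] i]| = (b0 + b1)%N.
Proof.
rewrite -sum1_card big_mkcond /= !big_ord_recl big_ord0 !inE /=.
by case: b0 b1 => [] [].
Qed.

Lemma card_set3 (b0 b1 b2 : bool) :
  #|[set i : 'I_3 | nth false [:: b0; b1; b2] i]| = (b0 + b1 + b2)%N.
Proof.
rewrite -sum1_card big_mkcond /= !big_ord_recl big_ord0 !inE /=.
by case: b0 b1 b2 => [] [] [].
Qed.

Variable J : 'End(V).

Lemma type_part3E p (a : cform R V 3) x y z :
  type_part J p a (args3 x y z) =
  \sum_(b0 : bool) \sum_(b1 : bool) \sum_(b2 : bool)
    (if (b0 + b1 + b2)%N == p then
       (2 ^+ 3)^-1 * \sum_(c0 : bool) \sum_(c1 : bool) \sum_(c2 : bool)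
         ((if c0 then if b0 then - 'i%C else 'i%C else 1) *
          ((if c1 then if b1 then - 'i%C else 'i%C else 1) *
           (if c2 then if b2 then - 'i%C else 'i%C else 1))) *
         a (args3 (if c0 then J x else x) (if c1 then J y else y)
                  (if c2 then J z else z))
     else 0).
Proof.
rewrite /type_part big_mkcond big_set3.
apply: eq_bigr => b0 _; apply: eq_bigr => b1 _; apply: eq_bigr => b2 _.
rewrite card_set3; case: eqP => // _; congr (_ * _).
rewrite big_set3.
apply: eq_bigr => c0 _; apply: eq_bigr => c1 _; apply: eq_bigr => c2 _.
congr (_ * a _).
  by rewrite big_mkcond /= !big_ord_recl big_ord0 !inE /= mulr1.
by apply/ffunP => -[[|[|[|//]]] lti]; rewrite !ffunE inE /=.
Qed.

(** For [omega] of type (1,1), [delbar] and [del] produce the (1,2) and (2,1) parts of its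
    differential, so this is the combination that enters [dc]. *)
Lemma type_part_diff (a : cform R V 3) x y z :
  'i%C * (type_part J 1 a (args3 x y z) - type_part J 2 a (args3 x y z)) =
  - (4^-1 * (a (args3 (J x) y z) + a (args3 x (J y) z) + a (args3 x y (J z))
    + 3 * a (args3 (J x) (J y) (J z)))).
Proof.
rewrite !type_part3E !big_bool /=.
have ii : 'i%C * 'i%C = -1 :> R[i] by rewrite -expr2 sqr_i.
do ![move: (a _) => ?].
(* The identity is polynomial in the imaginary unit, and only its square matters; it is made a
   variable subject to that relation. *)
set I := 'i%C in ii *; move: I ii => I ii.
by field: ii.
Qed.

Lemma type_part2E p (a : cform R V 2) x y :
  type_part J p a (args2 x y) =
  \sum_(b0 : bool) \sum_(b1 : bool)
    (if (b0 + b1)%N == p then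
       (2 ^+ 2)^-1 * \sum_(c0 : bool) \sum_(c1 : bool)
         ((if c0 then if b0 then - 'i%C else 'i%C else 1) *
          (if c1 then if b1 then - 'i%C else 'i%C else 1)) *
         a (args2 (if c0 then J x else x) (if c1 then J y else y))
     else 0).
Proof.
rewrite /type_part big_mkcond big_set2.
apply: eq_bigr => b0 _; apply: eq_bigr => b1 _.
rewrite card_set2; case: eqP => // _; congr (_ * _).
rewrite big_set2.
apply: eq_bigr => c0 _; apply: eq_bigr => c1 _.
congr (_ * a _).
  by rewrite big_mkcond /= !big_ord_recl big_ord0 !inE /= mulr1.
by apply/ffunP => -[[|[|//]] lti]; rewrite !ffunE inE /=.
Qed.

Lemma args2E (x : {ffun 'I_2 -> V}) : x = args2 (x ord0) (x ord_max).
Proof.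
by apply/ffunP => -[[|[|//]] lti]; rewrite !ffunE /=; congr (x _);
  apply: val_inj.
Qed.

Lemma args3E (x : {ffun 'I_3 -> V}) :
  x = args3 (x ord0) (x (inord 1)) (x ord_max).
Proof.
apply/ffunP => -[[|[|[|//]]] lti]; rewrite !ffunE /=; congr (x _);
  by apply: val_inj; rewrite //= inordK.
Qed.

Variable br : {bilinear V -> V -> V}.

Lemma ce_d2E (a : cform R V 2) x y z :
  ce_d br a (args3 x y z) =
  - a (args2 (br x y) z) + a (args2 (br x z) y) - a (args2 (br y z) x).
Proof.
have E (f : {ffun 'I_2 -> V}) u v :
    f ord0 = u -> f (lift ord0 ord0) = v -> f = args2 u v.
  move=> <- <-; rewrite [LHS]args2E; congr (args2 _ (f _)); exact: val_inj.
rewrite /ce_d; under eq_bigr do rewrite big_mkcond.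
rewrite !big_ord_recl !big_ord0 /=.
rewrite /bump /= !(add0r, addr0) !exprS expr0.
rewrite !(mulrN, mulNr, mul1r, mulr1, opprK) addrA.
by congr (- a _ + a _ - a _); apply: E;
  rewrite ffunE ?unlift_none ?liftK !ffunE.
Qed.

Lemma ce_d3E (a : cform R V 3) w x y z :
  ce_d br a (args4 w x y z) =
  - a (args3 (br w x) y z) + a (args3 (br w y) x z) - a (args3 (br x y) w z)
  - a (args3 (br w z) x y) + a (args3 (br x z) w y) - a (args3 (br y z) w x).
Proof.
have E (f : {ffun 'I_3 -> V}) s u v : f ord0 = s -> f (lift ord0 ord0) = u ->
    f (lift ord0 (lift ord0 ord0)) = v -> f = args3 s u v.
  move=> <- <- <-; rewrite [LHS]args3E; congr (args3 _ (f _) (f _));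
    by apply: val_inj; rewrite //= inordK.
rewrite /ce_d; under eq_bigr do rewrite big_mkcond.
rewrite !big_ord_recl !big_ord0 /=.
rewrite !add0r !addr0 /bump /= !addn0 ?add0n ?addn1 !exprS expr0.
rewrite !(mulrN, mulNr, mul1r, mulr1, opprK).
rewrite !addrA.
by congr (- a _ + a _ - a _ - a _ + a _ - a _); apply: E;
  rewrite ffunE ?unlift_none ?liftK !ffunE.
Qed.

Lemma ce_d0 k : @ce_d R V br k (fun=> 0) = fun=> 0.
Proof.
apply: funext => x; rewrite /ce_d big1 // => j _.
by rewrite big1 // => i _; rewrite mulr0.
Qed.

Lemma type_part0 p k : @type_part R V J k p (fun=> 0) = fun=> 0.
Proof.
apply: funext => x; rewrite /type_part big1 // => S _.
by rewrite big1 ?mulr0 // => i _; rewrite mulr0.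
Qed.

End Forms.

(** * The torsion of a Hermitian structure *)

Section Torsion.
Variables (R : realType) (V : vectType R) (g : {dot V for idfun}).
Variable br : {bilinear V -> V -> V}.

Lemma dotC x y : g x y = g y x.
Proof. by rewrite hermC expr0 mul1r. Qed.

Lemma dotDl x y z : g (x + y) z = g x z + g y z.
Proof. by rewrite linearDl. Qed.

Lemma dotDr x y z : g z (x + y) = g z x + g z y.
Proof. by rewrite linearDr. Qed.

Lemma dotNl x y : g (- x) y = - g x y.
Proof. by rewrite linearNl. Qed.

Lemma dotNr x y : g x (- y) = - g x y.
Proof. by rewrite linearNr. Qed.

Lemma dotZl a x y : g (a *: x) y = a * g x y.
Proof. by rewrite linearZl_LR. Qed.

Lemma dotZr a x y : g x (a *: y) = a * g x y.
Proof. by rewrite linearZr_LR. Qed.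

Lemma dot0l x : g 0 x = 0.
Proof. by rewrite linear0l. Qed.

Lemma dot0r x : g x 0 = 0.
Proof. by rewrite linear0r. Qed.

Lemma dot_gt0 x : x != 0 -> 0 < g x x.
Proof. exact: neq0_dnorm_gt0. Qed.

Lemma brDl x y z : br (x + y) z = br x z + br y z.
Proof. by rewrite linearDl. Qed.

Lemma brDr x y z : br z (x + y) = br z x + br z y.
Proof. by rewrite linearDr. Qed.

Lemma brNl x y : br (- x) y = - br x y.
Proof. by rewrite linearNl. Qed.

Lemma brNr x y : br x (- y) = - br x y.
Proof. by rewrite linearNr. Qed.

Lemma brZl a x y : br (a *: x) y = a *: br x y.
Proof. by rewrite linearZl_LR. Qed.

Lemma brZr a x y : br x (a *: y) = a *: br x y.
Proof. by rewrite linearZr_LR. Qed.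

Lemma br0l x : br 0 x = 0.
Proof. by rewrite linear0l. Qed.

Lemma br0r x : br x 0 = 0.
Proof. by rewrite linear0r. Qed.

Definition dotE := (dotDl, dotDr, dotNl, dotNr, dotZl, dotZr, dot0l, dot0r).
Definition brE := (brDl, brDr, brNl, brNr, brZl, brZr, br0l, br0r).

Definition torsion (J : 'End(V)) x y z : R :=
  g (br (J x) (J y)) z + g (br (J y) (J z)) x + g (br (J z) (J x)) y.

Hypothesis lie : is_lie_bracket br.

Lemma brC x y : br x y = - br y x.
Proof.
apply/eqP; rewrite -addr_eq0; apply/eqP; have := lie.1 (x + y).
by rewrite brDl !brDr !(lie.1) add0r addr0.
Qed.

Section Hermitian.
Variable J : 'End(V).
Hypothesis herm : hermitian_structure br J g.

Lemma herm_JJ x : J (J x) = - x.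
Proof. by case: herm => -[]. Qed.

Lemma dot_JJ x y : g (J x) (J y) = g x y.
Proof. by case: herm. Qed.

Lemma dot_Jl x y : g (J x) y = - g x (J y).
Proof. by rewrite -dot_JJ herm_JJ dotNl. Qed.

Lemma br_JJ x y : br (J x) (J y) = br x y + J (br (J x) y + br x (J y)).
Proof. by case: herm => -[_ /(_ x y)/subr0_eq]. Qed.

(** Integrability paired with a vector, after moving [J] across [g], for which it is skew. *)
Lemma dot_br_J x y z :
  g (br (J x) y + br x (J y)) (J z) = g (br x y) z - g (br (J x) (J y)) z.
Proof. by apply: oppr_inj; rewrite -dot_Jl br_JJ dotDl; ring. Qed.

Lemma fundamentalE x y : fundamental_form J g (args2 x y) = (g (J x) y)%:C.
Proof. by rewrite /fundamental_form !ffunE. Qed.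

(** Orthogonality of [J] makes the fundamental form of type (1,1). *)
Lemma type_part_fundamental p :
  type_part J p (fundamental_form J g) =
  if p == 1%N then fundamental_form J g else fun=> 0.
Proof.
apply: funext => x; rewrite (args2E x); move: (x ord0) (x ord_max) => {}x y.
rewrite [RHS](_ : _ = if p == 1%N then (g (J x) y)%:C else 0); last first.
  by case: (p == 1%N); rewrite ?fundamentalE.
have ii : 'i%C * 'i%C = -1 :> R[i] by rewrite -expr2 sqr_i.
rewrite type_part2E !big_bool /= !fundamentalE !dot_JJ herm_JJ dotNl.
rewrite rmorphN /=.
set I := 'i%C in ii *; move: I ii => I ii.
move: ((g x y)%:C) ((g (J x) y)%:C) => u v.
by case: p => [|[|[|p]]] /=; rewrite ?addr0 //; field: ii.
Qed.

(** Only the (1,1) part of the fundamental form survives, and [type_part_diff] expresses the result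
    through its differential. By [key], integrability trades one mixed bracket for the other, after
    which everything collapses to the cyclic sum. *)
Lemma dc_fundamental x y z :
  dc br J (fundamental_form J g) (args3 x y z) = (torsion J x y z)%:C.
Proof.
rewrite /dc /delbar /del !big_ord_recl !big_ord0 /=.
rewrite !type_part_fundamental /= !(ce_d0, type_part0) !(add0r, addr0).
rewrite type_part_diff !ce_d2E !fundamentalE !dot_JJ.
have key u v w : g (J (br (J u) v)) w =
    g (br (J u) (J v)) w - g (br u v) w - g (J (br u (J v))) w.
  rewrite !(dot_Jl _ w); have := dot_br_J u v w; rewrite dotDl => e.
  by rewrite -[g (br _ _) (J w)](addrK (g (br u (J v)) (J w))) e; ring.
rewrite /torsion !key [br (J z) _]brC dotNl.
by field.
Qed.

End Hermitian.
End Torsion.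

(** * The bracket table *)

(** The first identity gives [c * s >= 0], hence [c + s != 0]; [o3] and [o5] together give
    [s * t = 0]. If [s = 0], then [h33] and [h55] force [c ^+ 2 + t ^+ 2 = 0]. If [t = 0], then
    [p = b], [q = 2 * a] and [s = c], so [c ^+ 2] equals both [a ^+ 2 + b ^+ 2] and three times that
    sum. *)
Lemma nondegenerate_identities (R : realFieldType) (a b c p q s t : R) :
  2 * c * s = a ^+ 2 + b ^+ 2 + p ^+ 2 + (a - q) ^+ 2 + q ^+ 2 + (p + b) ^+ 2 ->
  c != 0 ->
  q * (p - b) = (p + b) * (q - 2 * a) ->
  (p + b) * (2 * a - q) - q * (b - p) + 4 * t * s = 0 ->
  (p - b) * (c + s) = q * t ->
  (2 * a - q) * (c + s) = (p + b) * t ->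
  4 * c ^+ 2 + (q - 2 * a) ^+ 2 + (p - b) ^+ 2 = q ^+ 2 + (p + b) ^+ 2 ->
  (2 * a - q) ^+ 2 + (b - p) ^+ 2 + 4 * s ^+ 2 =
    (p + b) ^+ 2 + q ^+ 2 + 4 * t ^+ 2 -> False.
Proof.
move=> cs c_neq0 o3 o5 h35 h45 h33 h55.
have c2 : 0 < c ^+ 2 by rewrite exprn_even_gt0.
have cs_ge0 : 0 <= c * s.
  have : 0 <= 2 * c * s by rewrite cs ?addr_ge0 ?sqr_ge0.
  by rewrite -mulrA pmulr_rge0.
have cs_neq0 : c + s != 0.
  apply/eqP => h; have sE : s = - c by lra.
  by move: cs_ge0; rewrite sE; nra.
have /eqP : s * t = 0 by lra.
rewrite mulf_eq0 => /orP[/eqP s0|/eqP t0].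
  by have := sqr_ge0 t; rewrite s0 in h55; lra.
have pb : p = b.
  apply/eqP; rewrite -subr_eq0; move: h35 => /eqP.
  by rewrite t0 mulr0 mulf_eq0 (negPf cs_neq0) orbF.
have qa : 2 * a = q.
  apply/eqP; rewrite -subr_eq0; move: h45 => /eqP.
  by rewrite t0 mulr0 mulf_eq0 (negPf cs_neq0) orbF.
have sc : s = c.
  have /eqP : (c + s) * (s - c) = 0 by rewrite t0 in h55; lra.
  by rewrite mulf_eq0 (negPf cs_neq0) subr_eq0 => /eqP.
by move: h33 cs; rewrite sc pb -qa; lra.
Qed.

(** * Invariance of the Bismut form *)

Section Core.
Variables (R : realType) (V : vectType R) (g : {dot V for idfun}).
Variables (br : {bilinear V -> V -> V}).
Hypothesis lie : is_lie_bracket br.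
Local Notation dotE := (@dotE R V g).
Local Notation brE := (@brE R V br).

(** The Bismut connection makes [J] parallel. Two instances of integrability suffice: the pair [x],
    [y] tested on [z], and the pair [z], [x] tested on [y]. *)
Lemma bismut_J (J : 'End(V)) (hJ : hermitian_structure br J g) x y z :
  g (br x (J y)) (J z) - g (br (J y) (J z)) x + g (br (J z) x) (J y)
    - torsion g br J x (J y) (J z) =
  g (br x y) z - g (br y z) x + g (br z x) y - torsion g br J x y z.
Proof.
have eyz := dot_br_J hJ x y z; have ezy := dot_br_J hJ z x y.
rewrite !dotDl in eyz ezy.
rewrite /torsion !(herm_JJ hJ) !(brE, dotE) opprK.
rewrite -[g (br (J x) y) (J z)](addKr (g (br x (J y)) (J z))).
rewrite [_ + g (br (J x) y) (J z)]addrC eyz.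
rewrite -[g (br z (J x)) (J y)](addKr (g (br (J z) x) (J y))) ezy; ring.
Qed.

Variables (J I : 'End(V)).
Hypothesis (hJ : hermitian_structure br J g) (hI : hermitian_structure br I g).
Hypothesis torsJI :
  forall x y z, torsion g br J x y z + torsion g br I x y z = 0.
Hypothesis dtors : forall w x y z,
  - torsion g br J (br w x) y z + torsion g br J (br w y) x z
  - torsion g br J (br x y) w z - torsion g br J (br w z) x y
  + torsion g br J (br x z) w y - torsion g br J (br y z) w x = 0.

Let JD x y : J (x + y) = J x + J y. Proof. exact: linearD. Qed.
Let JN x : J (- x) = - J x. Proof. exact: linearN. Qed.
Let JZ a x : J (a *: x) = a *: J x. Proof. exact: linearZ. Qed.
Let J0 : J 0 = 0. Proof. exact: linear0. Qed.
Let JE := (JD, JN, JZ, J0).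

(** Twice the Bismut connection of [I], with the torsion of [I] replaced by minus that of [J]. It is
    thus computable from the brackets and [J] alone, while its invariance constrains [I]. *)
Definition bismut x y z :=
  g (br x y) z - g (br y z) x + g (br z x) y + torsion g br J x y z.

Lemma bismut_I x y z : bismut x (I y) (I z) = bismut x y z.
Proof.
have e u v w : torsion g br J u v w = - torsion g br I u v w.
  by apply/eqP; rewrite -addr_eq0 torsJI.
by rewrite /bismut !e bismut_J.
Qed.

Lemma bismutDr x y z z' : bismut x y (z + z') = bismut x y z + bismut x y z'.
Proof. by rewrite /bismut /torsion !(JE, brE, dotE); ring. Qed.
Lemma bismutZr x y a z : bismut x y (a *: z) = a * bismut x y z.
Proof. by rewrite /bismut /torsion !(JE, brE, dotE); ring. Qed.
Lemma bismutC x y z : bismut x y z = - bismut x z y.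
Proof.
rewrite /bismut /torsion (brC lie z x) (brC lie z y) (brC lie y x).
rewrite (brC lie (J z) (J x)) (brC lie (J z) (J y)) (brC lie (J y) (J x)).
by rewrite !dotE; ring.
Qed.

(** An [I]-invariant form that is skew in its last two arguments becomes symmetric when [I] is
    applied to one of them. All information on [I] is extracted this way: a vanishing row on one
    side kills a component of an image of [I] on the other. *)
Lemma bismut_sym x y z : bismut x y (I z) = bismut x z (I y).
Proof.
by rewrite -bismut_I (herm_JJ hI) -scaleN1r bismutZr mulN1r -bismutC.
Qed.

(** * Brackets in a basis adapted to [J] and the nilradical *)

Variables e1 e2 e3 e4 e5 e6 : V.
Let e := [:: e1; e2; e3; e4; e5; e6].
Hypothesis (J1 : J e1 = e2) (J3 : J e3 = e4) (J6 : J e6 = e5).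
Hypothesis gram :
  forall i j, (i < 6)%N -> (j < 6)%N -> g e`_i e`_j = (i == j)%:R.
Hypothesis complete : forall x, x = \sum_(i < 6) g x e`_i *: e`_i.
Hypothesis central : forall x, br e1 x = 0.
Hypothesis im6 : forall x y, g (br x y) e6 = 0.
Hypothesis derived : forall x y, g x e6 = 0 -> g y e6 = 0 ->
  br x y = g (br x y) e1 *: e1.
Hypothesis br34 : br e3 e4 != 0.

Let gramE :
    (g e1 e1 = 1) * (g e1 e2 = 0) * (g e1 e3 = 0)
  * (g e1 e4 = 0) * (g e1 e5 = 0) * (g e1 e6 = 0)
  * (g e2 e1 = 0) * (g e2 e2 = 1) * (g e2 e3 = 0)
  * (g e2 e4 = 0) * (g e2 e5 = 0) * (g e2 e6 = 0)
  * (g e3 e1 = 0) * (g e3 e2 = 0) * (g e3 e3 = 1)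
  * (g e3 e4 = 0) * (g e3 e5 = 0) * (g e3 e6 = 0)
  * (g e4 e1 = 0) * (g e4 e2 = 0) * (g e4 e3 = 0)
  * (g e4 e4 = 1) * (g e4 e5 = 0) * (g e4 e6 = 0)
  * (g e5 e1 = 0) * (g e5 e2 = 0) * (g e5 e3 = 0)
  * (g e5 e4 = 0) * (g e5 e5 = 1) * (g e5 e6 = 0)
  * (g e6 e1 = 0) * (g e6 e2 = 0) * (g e6 e3 = 0)
  * (g e6 e4 = 0) * (g e6 e5 = 0) * (g e6 e6 = 1).
Proof.
have o i j : (i < 6)%N && (j < 6)%N -> g e`_i e`_j = (i == j)%:R.
  by case/andP; exact: gram.
exact: (o 0 0 isT, o 0 1 isT, o 0 2 isT, o 0 3 isT, o 0 4 isT, o 0 5 isT,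
  o 1 0 isT, o 1 1 isT, o 1 2 isT, o 1 3 isT, o 1 4 isT, o 1 5 isT,
  o 2 0 isT, o 2 1 isT, o 2 2 isT, o 2 3 isT, o 2 4 isT, o 2 5 isT,
  o 3 0 isT, o 3 1 isT, o 3 2 isT, o 3 3 isT, o 3 4 isT, o 3 5 isT,
  o 4 0 isT, o 4 1 isT, o 4 2 isT, o 4 3 isT, o 4 4 isT, o 4 5 isT,
  o 5 0 isT, o 5 1 isT, o 5 2 isT, o 5 3 isT, o 5 4 isT, o 5 5 isT).
Qed.

Let J2 : J e2 = - e1. Proof. by rewrite -J1 (herm_JJ hJ). Qed.
Let J4 : J e4 = - e3. Proof. by rewrite -J3 (herm_JJ hJ). Qed.
Let J5 : J e5 = - e6. Proof. by rewrite -J6 (herm_JJ hJ). Qed.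
Let Je := (J1, J2, J3, J4, J5, J6).

Let decomp x : x = g x e1 *: e1 + g x e2 *: e2 + g x e3 *: e3 + g x e4 *: e4
   + g x e5 *: e5 + g x e6 *: e6.
Proof. by rewrite [LHS]complete !big_ord_recl big_ord0 /= addr0 !addrA. Qed.

Let central' x : br x e1 = 0. Proof. by rewrite brC // central oppr0. Qed.

(** With [e1] central, integrability at [e1] and [y] says that the adjoint action of [e2] commutes
    with [J]. *)
Let J_br2 y : br e2 (J y) = J (br e2 y).
Proof. by rewrite -{1}J1 (br_JJ hJ) !central add0r addr0 J1. Qed.

Lemma bracket_table : exists c L a b p q A B s t u v m,
  [/\ br e2 e3 = 0, br e2 e4 = 0, br e2 e5 = L *: e1, br e3 e4 = c *: e1 &
      br e3 e5 = a *: e1] /\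
  [/\ br e4 e5 = b *: e1, br e6 e2 = L *: e2,
      br e6 e3 = p *: e1 + q *: e2 + A *: e3 + B *: e4,
      br e6 e4 = (a - q) *: e1 + (p + b) *: e2 - B *: e3 + A *: e4 &
      br e6 e5 = s *: e1 + t *: e2 + u *: e3 + v *: e4 + m *: e5].
Proof.
have line x y : g x e6 = 0 -> g y e6 = 0 -> exists k, br x y = k *: e1.
  by move=> x6 y6; eexists; exact: derived.
have [L b25] : exists L, br e2 e5 = L *: e1 by apply: line; rewrite gramE.
have [c b34] : exists c, br e3 e4 = c *: e1 by apply: line; rewrite gramE.
have [a b35] : exists a, br e3 e5 = a *: e1 by apply: line; rewrite gramE.
have [b b45] : exists b, br e4 e5 = b *: e1 by apply: line; rewrite gramE.
have [k b23] : exists k, br e2 e3 = k *: e1 by apply: line; rewrite gramE.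
have [k' b24] : exists k, br e2 e4 = k *: e1 by apply: line; rewrite gramE.
(* The bracket of [e2] with [e4] is [J] of its bracket with [e3]; both lie on the line of [e1],
   which [J] moves to that of [e2], so both vanish. *)
have h23 : k' *: e1 = k *: e2 by rewrite -b24 -J3 J_br2 b23 JZ J1.
have k0 : k = 0.
  by have := congr1 (g e2) h23; rewrite !dotE !gramE mulr0 mulr1.
have k'0 : k' = 0.
  by have := congr1 (g e1) h23; rewrite !dotE !gramE mulr0 mulr1.
have b62 : br e6 e2 = L *: e2.
  have := J_br2 e6; rewrite J6 b25 => /(congr1 J).
  by rewrite (herm_JJ hJ) JZ J1 (brC lie e6) => <-.
(* Integrability at [e3] and [e6] determines this bracket from [br e6 e3]. *)
have b64J : br e6 e4 = J (br e6 e3) + a *: e1 + b *: e2.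
  have := br_JJ hJ e3 e6; rewrite J3 J6 b35 b45 => /(congr1 J).
  rewrite !(JD, JZ) J1 !(herm_JJ hJ) (brC lie e3) (brC lie e4) JN => ->.
  by rewrite J2 opprK scalerN addrACA addrN add0r addrC addrNK.
have b63 := decomp (br e6 e3); have b65 := decomp (br e6 e5).
rewrite im6 scale0r addr0 in b63; rewrite im6 scale0r addr0 in b65.
(* [J] would turn an [e5]-component into an [e6]-component of [br e6 e4], contrary to [im6]. *)
have r0 : g (br e6 e3) e5 = 0.
  have := im6 e6 e4; rewrite b64J b63; move: (g (br e6 e3)) => h.
  by rewrite !(JE, Je, dotE) !gramE; lra.
move: b63 b65 b64J.
move: {r0}(g _ e5) r0 (g _ e1) (g _ e2) (g _ e3) (g _ e4) => _ -> p q A B.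
move: (g _ e1) (g _ e2) (g _ e3) (g _ e4) (g _ e5) => s t u v m.
rewrite scale0r addr0 => b63 b65; rewrite b63 !JE !Je => b64.
exists c, L, a, b, p, q, A, B, s, t, u, v, m; split; split=> //.
- by rewrite b23 k0 scale0r.
- by rewrite b24 k'0 scale0r.
by rewrite b64 [LHS]decomp [RHS]decomp !dotE !gramE;
  congr (_ *: _ + _ *: _ + _ *: _ + _ *: _ + _ *: _ + _ *: _); ring.
Qed.

Section Table.
Variables c L a b p q A B s t u v m : R.
Hypothesis b23 : br e2 e3 = 0.
Hypothesis b24 : br e2 e4 = 0.
Hypothesis b25 : br e2 e5 = L *: e1.
Hypothesis b34 : br e3 e4 = c *: e1.
Hypothesis b35 : br e3 e5 = a *: e1.
Hypothesis b45 : br e4 e5 = b *: e1.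
Hypothesis b62 : br e6 e2 = L *: e2.
Hypothesis b63 : br e6 e3 = p *: e1 + q *: e2 + A *: e3 + B *: e4.
Hypothesis b64 : br e6 e4 = (a - q) *: e1 + (p + b) *: e2 - B *: e3 + A *: e4.
Hypothesis b65 : br e6 e5 = s *: e1 + t *: e2 + u *: e3 + v *: e4 + m *: e5.

Let brT := (central, central',
  lie.1 e2, lie.1 e3, lie.1 e4, lie.1 e5, lie.1 e6,
  brC lie e3 e2, brC lie e4 e2, brC lie e5 e2, brC lie e4 e3,
  brC lie e5 e3, brC lie e5 e4, brC lie e2 e6, brC lie e3 e6,
  brC lie e4 e6, brC lie e5 e6,
  b23, b24, b25, b34, b35,
  b45, b62, b63, b64, b65).

Ltac expand := rewrite /torsion;
  repeat progress (rewrite ?brT ?JE ?Je ?brE); rewrite ?dotE ?gramE.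

Let c_neq0 : c != 0.
Proof. by apply: contraNneq br34 => c0; rewrite b34 c0 scale0r. Qed.

(** As a derivation, the adjoint action of [e6] multiplies [br e3 e4 = c *: e1] by [2 * A], yet it
    kills the central vector [e1]. [LLm_eq0] comes likewise from [br e2 e5]. *)
Lemma A_eq0 : A = 0.
Proof.
have := congr1 (g e1) (lie.2 e6 e3 e4); expand => h.
have /eqP : A * c = 0 by lra.
by rewrite mulf_eq0 (negPf c_neq0) orbF => /eqP.
Qed.

Lemma LLm_eq0 : L * (L + m) = 0.
Proof. by have := congr1 (g e1) (lie.2 e6 e2 e5); expand; lra. Qed.

(** Together with [dtorsion2456] this is a linear system in [q] and [p + b] with determinant
    [B ^+ 2 + (2 * L + m) ^+ 2]; it produces the case split of [table_absurd]. *)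
Lemma dtorsion2356 : q * B = (p + b) * (2 * L + m).
Proof. by have := dtors e2 e3 e5 e6; expand; rewrite A_eq0; lra. Qed.

Lemma dtorsion2456 : q * (2 * L + m) = - (p + b) * B.
Proof. by have := dtors e2 e4 e5 e6; expand; rewrite A_eq0; lra. Qed.

Lemma dtorsion3456 : L = 0 -> m = 0 -> B = 0 ->
  2 * c * s = a ^+ 2 + b ^+ 2 + p ^+ 2 + (a - q) ^+ 2 + q ^+ 2 + (p + b) ^+ 2.
Proof.
move=> L0 m0 B0; have := dtors e3 e4 e5 e6; expand.
by rewrite A_eq0 L0 m0 B0; lra.
Qed.

(** * The Bismut form in the adapted basis *)

Lemma bismut_row x y z : bismut x y z =
  g z e1 * bismut x y e1 + g z e2 * bismut x y e2 + g z e3 * bismut x y e3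
  + g z e4 * bismut x y e4 + g z e5 * bismut x y e5 + g z e6 * bismut x y e6.
Proof. by rewrite {1}(decomp z) !(bismutDr, bismutZr). Qed.

(* Hiding [g (br x y) z] behind a trilinear form makes the rewriting below much
   cheaper than expanding brackets of vectors. *)
Let T x y z := g (br x y) z.
Let TE x y z : g (br x y) z = T x y z. Proof. by []. Qed.
Let TNl x y z : T (- x) y z = - T x y z.
Proof. by rewrite /T brNl dotNl. Qed.
Let TNr x y z : T x (- y) z = - T x y z.
Proof. by rewrite /T brNr dotNl. Qed.
Let T0 : (forall x z, T e1 x z = 0) * (forall x z, T x e1 z = 0)
  * (forall x z, T x x z = 0)
  * (forall z, T e2 e3 z = 0) * (forall z, T e3 e2 z = 0)
  * (forall z, T e2 e4 z = 0) * (forall z, T e4 e2 z = 0).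
Proof.
by (do !split) => *; rewrite /T ?central ?central' ?(lie.1) ?b23 ?b24
  ?(brC lie _ e2) ?b23 ?b24 ?oppr0 dot0l.
Qed.

Let T25 z : T e2 e5 z = L * g e1 z.
Proof. by rewrite /T b25 !dotE. Qed.
Let T34 z : T e3 e4 z = c * g e1 z.
Proof. by rewrite /T b34 !dotE. Qed.
Let T35 z : T e3 e5 z = a * g e1 z.
Proof. by rewrite /T b35 !dotE. Qed.
Let T45 z : T e4 e5 z = b * g e1 z.
Proof. by rewrite /T b45 !dotE. Qed.
Let T62 z : T e6 e2 z = L * g e2 z.
Proof. by rewrite /T b62 !dotE. Qed.
Let T63 z : T e6 e3 z = p * g e1 z + q * g e2 z + B * g e4 z.
Proof. by rewrite /T b63 A_eq0 scale0r ?addr0 !dotE. Qed.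
Let T64 z :
  T e6 e4 z = (a - q) * g e1 z + (p + b) * g e2 z - B * g e3 z.
Proof. by rewrite /T b64 A_eq0 scale0r addr0 !dotE. Qed.
Let T65 z :
  T e6 e5 z = s * g e1 z + t * g e2 z + u * g e3 z + v * g e4 z + m * g e5 z.
Proof. by rewrite /T b65 !dotE. Qed.
Let TC x y z : T x y z = - T y x z.
Proof. by rewrite /T (brC lie) dotNl. Qed.
Let TT := (TC e5 e2, TC e4 e3, TC e5 e3, TC e5 e4,
  TC e2 e6, TC e3 e6, TC e4 e6, TC e5 e6,
  T25, T34, T35, T45, T62, T63, T64, T65).

Ltac row :=
  rewrite bismut_row /bismut /torsion !Je !TE ?(TNl, TNr) ?T0 ?TT ?gramE; lra.

Lemma bismut11 z : bismut e1 e1 z = 0.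
Proof. row. Qed.

Lemma bismut12 z : bismut e1 e2 z = - 2 * L * g z e5.
Proof. row. Qed.

Lemma bismut13 z : bismut e1 e3 z = - q * g z e5 + (p + b) * g z e6.
Proof. row. Qed.

Lemma bismut14 z : bismut e1 e4 z = - q * g z e6 - (p + b) * g z e5.
Proof. row. Qed.

Lemma bismut15 z :
  bismut e1 e5 z = 2 * L * g z e2 + q * g z e3 + (p + b) * g z e4.
Proof. row. Qed.

Lemma bismut16 z : bismut e1 e6 z = q * g z e4 - (p + b) * g z e3.
Proof. row. Qed.

Lemma bismut25 z : bismut e2 e5 z = - (p + b) * g z e3 + q * g z e4.
Proof. row. Qed.

Lemma bismut26 z :
  bismut e2 e6 z = - 2 * L * g z e2 - q * g z e3 - (p + b) * g z e4.
Proof. row. Qed.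

Lemma bismut31 z : bismut e3 e1 z =
  - 2 * c * g z e4 + (q - 2 * a) * g z e5 + (p - b) * g z e6.
Proof. row. Qed.

Lemma bismut32 z : bismut e3 e2 z = q * g z e6 - (p + b) * g z e5.
Proof. row. Qed.

Lemma bismut33 z : bismut e3 e3 z = 0.
Proof. row. Qed.

Lemma bismut34 z : bismut e3 e4 z = 2 * c * g z e1.
Proof. row. Qed.

Lemma bismut35 z :
  bismut e3 e5 z = (2 * a - q) * g z e1 + (p + b) * g z e2.
Proof. row. Qed.

Lemma bismut36 z : bismut e3 e6 z = (b - p) * g z e1 - q * g z e2.
Proof. row. Qed.

Lemma bismut41 z : bismut e4 e1 z =
  2 * c * g z e3 + (p - b) * g z e5 + (2 * a - q) * g z e6.
Proof. row. Qed.

Lemma bismut42 z : bismut e4 e2 z = q * g z e5 + (p + b) * g z e6.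
Proof. row. Qed.

Lemma bismut43 z : bismut e4 e3 z = - 2 * c * g z e1.
Proof. row. Qed.

Lemma bismut44 z : bismut e4 e4 z = 0.
Proof. row. Qed.

Lemma bismut45 z : bismut e4 e5 z = (b - p) * g z e1 - q * g z e2.
Proof. row. Qed.

Lemma bismut46 z :
  bismut e4 e6 z = (q - 2 * a) * g z e1 - (p + b) * g z e2.
Proof. row. Qed.

Lemma bismut51 z : bismut e5 e1 z =
  (2 * a - q) * g z e3 + (b - p) * g z e4 + 2 * s * g z e6.
Proof. row. Qed.

Lemma bismut52 z : bismut e5 e2 z =
  (p + b) * g z e3 - q * g z e4 + 2 * t * g z e6.
Proof. row. Qed.

(** * The degenerate and the nondegenerate case *)

Let gI x y : g (I x) y = - g x (I y).
Proof. exact: (dot_Jl hI). Qed.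
Let gII x y : g (I x) (I y) = g x y.
Proof. exact: (dot_JJ hI). Qed.

Lemma norm_sum x : g x x = g x e1 ^+ 2 + g x e2 ^+ 2 + g x e3 ^+ 2 + g x e4 ^+ 2
  + g x e5 ^+ 2 + g x e6 ^+ 2.
Proof. by rewrite {2}(decomp x) !(dotDr, dotZr) !expr2. Qed.

Lemma gIxx x : g (I x) x = 0.
Proof. by have := gI x x; rewrite (dotC g x); lra. Qed.

Lemma c2_gt0 : 0 < c ^+ 2.
Proof. by rewrite exprn_even_gt0. Qed.

(** If [L != 0], every component of [I e5] vanishes. If [L = 0], two orthogonal nonzero vectors are
    sent by [I] to the line of [e1]. Both contradict that [I] is an isometry. *)
Lemma table_degenerate : q = 0 -> p + b = 0 -> False.
Proof.
move=> q0 l0.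
have [L0|L_neq0] := eqVneq L 0; last first.
  (* The row of [e1], [e2] is a nonzero multiple of the [e5]-component, so symmetry against a
     vanishing row of [e1] gives a component of [I e5]. *)
  have w5 k : (forall z, bismut e1 k z = 0) -> g (I k) e5 = 0.
    move=> k0; have := bismut_sym e1 e2 k; rewrite k0 bismut12 => /eqP.
    by rewrite !mulf_eq0 (negPf L_neq0) oppr_eq0 pnatr_eq0 /= => /eqP.
  have w1 : g (I e1) e5 = 0 by apply: w5 => z; rewrite bismut11.
  have w3 : g (I e3) e5 = 0 by apply: w5 => z; rewrite bismut13 q0 l0; ring.
  have w4 : g (I e4) e5 = 0 by apply: w5 => z; rewrite bismut14 q0 l0; ring.
  have w6 : g (I e6) e5 = 0 by apply: w5 => z; rewrite bismut16 q0 l0; ring.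
  have w2 : g (I e5) e2 = 0.
    have := bismut_sym e2 e6 e5; rewrite bismut25 bismut26 q0 l0 => h.
    have /eqP : L * g (I e5) e2 = 0 by lra.
    by rewrite mulf_eq0 (negPf L_neq0) => /eqP.
  have := norm_sum (I e5).
  rewrite gII gIxx w2 !(gI e5) !(dotC g e5) w1 w3 w4 w6 gramE.
  by move/eqP; rewrite oppr0 expr0n /= !addr0 oner_eq0.
have bp : p = - b by lra.
(* Up to the factors -2 and 2, [X] and [Y] represent the rows [bismut31] and [bismut41]. They are
   orthogonal with equal norm. *)
pose X := c *: e4 + a *: e5 + b *: e6.
pose Y := c *: e3 - b *: e5 + a *: e6.
have X31 z : bismut e3 e1 z = - 2 * g X z.
  by rewrite bismut31 q0 bp !dotE !(dotC g _ z); ring.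
have Y41 z : bismut e4 e1 z = 2 * g Y z.
  by rewrite bismut41 q0 bp !dotE !(dotC g _ z); ring.
have I11 := gIxx e1.
(* For each basis vector [k] other than [e1], the row of [e3] and [k] is zero or a multiple of the
   [e1]-component, which vanishes at [I e1]. *)
have IX k : bismut e3 k (I e1) = 0 -> g (I X) k = 0.
  by move=> h; rewrite gI; have := bismut_sym e3 e1 k; rewrite X31 h; lra.
have IY k : bismut e4 k (I e1) = 0 -> g (I Y) k = 0.
  by move=> h; rewrite gI; have := bismut_sym e4 e1 k; rewrite Y41 h; lra.
have IX1 : I X = g (I X) e1 *: e1.
  rewrite {1}(decomp (I X)) (IX e2) ?(IX e3) ?(IX e4) ?(IX e5) ?(IX e6);
    rewrite ?scale0r ?addr0 //.
  - by rewrite bismut36 I11 q0; ring.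
  - by rewrite bismut35 I11 q0 l0; ring.
  - by rewrite bismut34 I11; ring.
  - by rewrite bismut33.
  - by rewrite bismut32 q0 l0; ring.
have IY1 : I Y = g (I Y) e1 *: e1.
  rewrite {1}(decomp (I Y)) (IY e2) ?(IY e3) ?(IY e4) ?(IY e5) ?(IY e6);
    rewrite ?scale0r ?addr0 //.
  - by rewrite bismut46 I11 q0 l0; ring.
  - by rewrite bismut45 I11 q0 ; ring.
  - by rewrite bismut44.
  - by rewrite bismut43 I11; ring.
  - by rewrite bismut42 q0 l0; ring.
move: (g (I X) e1) (g (I Y) e1) IX1 IY1 => x y IX1 IY1.
have XX : x ^+ 2 = c ^+ 2 + a ^+ 2 + b ^+ 2.
  have := gII X X; rewrite IX1 !dotE !gramE; lra.
have YY : y ^+ 2 = c ^+ 2 + a ^+ 2 + b ^+ 2.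
  have := gII Y Y; rewrite IY1 !dotE !gramE; lra.
have XY : x * y = 0.
  have := gII X Y; rewrite IX1 IY1 !dotE !gramE; lra.
have : (x * y) ^+ 2 = (c ^+ 2 + a ^+ 2 + b ^+ 2) ^+ 2 by rewrite exprMn XX YY.
rewrite XY expr0n /= => /esym/eqP; rewrite sqrf_eq0 => /eqP h.
by have := c2_gt0; have := sqr_ge0 a; have := sqr_ge0 b; lra.
Qed.

Lemma table_nondegenerate : q ^+ 2 + (p + b) ^+ 2 != 0 ->
  L = 0 -> m = 0 -> B = 0 -> False.
Proof.
set r2 := q ^+ 2 + _ => r2_neq0 L0 m0 B0.
(* Every row of [e1] vanishes at [I e1]; as [q] and [p + b] are not both zero, this leaves only the
   [e2]-component of [I e1]. *)
have sym1 z : bismut e1 z (I e1) = 0 by rewrite -bismut_sym bismut11.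
have := sym1 e3; have := sym1 e4; have := sym1 e5; have := sym1 e6.
rewrite bismut13 bismut14 bismut15 bismut16 L0 !mulr0 !mul0r add0r.
move=> h6 h5 h4 h3.
have mul0 (k x : R) : x = 0 -> k * x = 0 by move=> ->; rewrite mulr0.
have cancel x : r2 * x = 0 -> x = 0.
  by move=> /eqP; rewrite mulf_eq0 (negPf r2_neq0) => /eqP.
have w3 : g (I e1) e3 = 0.
  by apply: cancel; have := mul0 q _ h5; have := mul0 (p + b) _ h6;
    rewrite /r2; lra.
have w4 : g (I e1) e4 = 0.
  by apply: cancel; have := mul0 (p + b) _ h5; have := mul0 q _ h6;
    rewrite /r2; lra.
have w5 : g (I e1) e5 = 0.
  by apply: cancel; have := mul0 q _ h3; have := mul0 (p + b) _ h4;
    rewrite /r2; lra.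
have w6 : g (I e1) e6 = 0.
  by apply: cancel; have := mul0 (p + b) _ h3; have := mul0 q _ h4;
    rewrite /r2; lra.
have w1 := gIxx e1.
have := decomp (I e1); rewrite w1 w3 w4 w5 w6 !scale0r !addr0 add0r.
move: (g (I e1) e2) => eps Ie1.
have eps2 : eps ^+ 2 = 1.
  by have := gII e1 e1; rewrite Ie1 !dotE !gramE !mulr1.
(* Since [I e1 = eps *: e2], the vector representing the row of [k] and [e1] is sent by [I] to [eps]
   times the one representing the row of [k] and [e2]. *)
have IX k X Y : (forall z, bismut k e1 z = g X z) ->
    (forall z, bismut k e2 z = g Y z) -> forall z, g (I X) z = eps * g Y z.
  move=> hX hY z; rewrite gI -hX bismut_sym bismutC Ie1.
  by rewrite bismutC bismutZr -[bismut k z e2]opprK -bismutC hY; ring.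
pose X3 := - (2 * c) *: e4 + (q - 2 * a) *: e5 + (p - b) *: e6.
pose Y3 := q *: e6 - (p + b) *: e5.
pose X4 := (2 * c) *: e3 + (p - b) *: e5 + (2 * a - q) *: e6.
pose Y4 := q *: e5 + (p + b) *: e6.
pose X5 := (2 * a - q) *: e3 + (b - p) *: e4 + (2 * s) *: e6.
pose Y5 := (p + b) *: e3 - q *: e4 + (2 * t) *: e6.
have I3 : forall z, g (I X3) z = eps * g Y3 z.
  by apply: (IX e3) => z; rewrite (bismut31, bismut32) !dotE !(dotC g _ z);
    ring.
have I4 : forall z, g (I X4) z = eps * g Y4 z.
  by apply: (IX e4) => z; rewrite (bismut41, bismut42) !dotE !(dotC g _ z);
    ring.
have I5 : forall z, g (I X5) z = eps * g Y5 z.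
  by apply: (IX e5) => z; rewrite (bismut51, bismut52) !dotE !(dotC g _ z);
    ring.
(* That [I] is an isometry and skew now gives scalar identities among the rows: [isom] compares
   inner products, [orth] gives orthogonality. *)
have isom X Y X' Y' : (forall z, g (I X) z = eps * g Y z) ->
    (forall z, g (I X') z = eps * g Y' z) -> g X X' = g Y Y'.
  move=> hX hX'; rewrite -gII hX dotC hX' mulrA -expr2 eps2 mul1r; exact: dotC.
have orth X Y : (forall z, g (I X) z = eps * g Y z) -> g Y X = 0.
  by move=> hX; rewrite -[LHS]mul1r -eps2 expr2 -mulrA -hX gIxx mulr0.
apply: (nondegenerate_identities (t := t) (dtorsion3456 L0 m0 B0) c_neq0).
- by have := orth _ _ I3; rewrite !dotE !gramE; lra.
- by have := orth _ _ I5; rewrite !dotE !gramE; lra.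
- by have := isom _ _ _ _ I3 I5; rewrite !dotE !gramE; lra.
- by have := isom _ _ _ _ I4 I5; rewrite !dotE !gramE; lra.
- by have := isom _ _ _ _ I3 I3; rewrite !dotE !gramE; lra.
by have := isom _ _ _ _ I5 I5; rewrite !dotE !gramE; lra.
Qed.

Lemma table_absurd : False.
Proof.
have h1 := dtorsion2356; have h2 := dtorsion2456; have h3 := LLm_eq0.
have [r0|r_neq0] := eqVneq (q ^+ 2 + (p + b) ^+ 2) 0.
  move/eqP: r0; rewrite paddr_eq0 ?sqr_ge0 // !sqrf_eq0.
  move=> /andP[/eqP q0 /eqP l0].
  exact: table_degenerate.
(* [N] is the determinant of the linear system; as [q] and [p + b] are not both zero, it vanishes,
   and [LLm_eq0] then forces [L = 0]. *)
set N := (2 * L + m) ^+ 2 + B ^+ 2.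
have mul0 (k x y : R) : x = y -> k * x = k * y by move=> ->.
have qN : q * N = 0.
  have := mul0 B _ _ h1; have := mul0 (2 * L + m) _ _ h2; rewrite /N; lra.
have lN : (p + b) * N = 0.
  have := mul0 (2 * L + m) _ _ h1; have := mul0 B _ _ h2; rewrite /N; lra.
have : (q ^+ 2 + (p + b) ^+ 2) * N = 0.
  by rewrite mulrDl !expr2 -!mulrA qN lN !mulr0 addr0.
move=> /eqP; rewrite mulf_eq0 (negPf r_neq0) /= paddr_eq0 ?sqr_ge0 // !sqrf_eq0.
case/andP=> /eqP w0 /eqP B0.
have L0 : L = 0.
  apply/eqP; rewrite -sqrf_eq0; apply/eqP.
  have mE : m = - 2 * L by lra.
  by move: h3; rewrite mE; lra.
by apply: table_nondegenerate => //; lra.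
Qed.

End Table.

Lemma no_adapted_basis : False.
Proof.
have [c [L [a [b [p [q [A [B [s [t [u [v [m]]]]]]]]]]]]] := bracket_table.
move=> [[b23 b24 b25 b34 b35] [b45 b62 b63 b64 b65]].
exact: (table_absurd b23 b24 b25 b34 b35 b45 b62 b63 b64 b65).
Qed.

End Core.

(** * Adapted bases *)

Section Euclidean.
Variables (R : realType) (V : vectType R) (g : {dot V for idfun}).

Lemma dot_sumr x (J : Type) (r : seq J) (F : J -> V) :
  g x (\sum_(i <- r) F i) = \sum_(i <- r) g x (F i).
Proof. exact: (big_morph (g x) (fun y z => dotDr g y z x) (dot0r g x)). Qed.

Lemma unit_multiple (x : V) : x != 0 -> exists k : R, g (k *: x) (k *: x) = 1.
Proof.
move=> /(dot_gt0 g) gx; exists (Num.sqrt (g x x))^-1.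
rewrite dotZl dotZr mulrA -invfM -expr2 sqr_sqrtr ?ltW // mulVf //.
by rewrite gt_eqF.
Qed.

(** Each orthogonality condition lowers the dimension by at most one. *)
Lemma orthogonal_seq_neq0 (s : seq V) (U : {vspace V}) :
  (size s < \dim U)%N ->
  exists x, [/\ x != 0, x \in U & forall y, y \in s -> g x y = 0].
Proof.
elim: s U => [|y s IHs] U /= ltsU.
  exists (vpick U); split=> //; last exact: memv_pick.
  by rewrite vpick0 -dimv_eq0 -lt0n.
have [|x [x0]] := IHs (U :&: orthov g <[y]>)%VS.
  by apply: leq_trans (leq_dim_orthov1 g y U); case: (\dim U) ltsU.
rewrite memv_cap => /andP[xU xy] xs; exists x; split=> // z.
rewrite inE => /predU1P[->|/xs //].
by move/mem_orthovP: xy; apply; exact: memv_line.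
Qed.

Lemma orthov_neq0 (U : {vspace V}) : (\dim U < \dim {:V})%N ->
  exists2 x, x != 0 & forall u, u \in U -> g x u = 0.
Proof.
move=> ltUV.
have [|x [x0 _ xU]] := @orthogonal_seq_neq0 (vbasis U) fullv.
  by rewrite size_tuple.
exists x => // u /coord_vbasis ->; rewrite dot_sumr big1 // => i _.
by rewrite dotZr xU ?mulr0 // mem_nth ?size_tuple.
Qed.

Lemma orthonormal_decomp (s : 6.-tuple V) : \dim {:V} = 6%N ->
  (forall i j : 'I_6, g s`_i s`_j = (i == j)%:R) ->
  forall x, x = \sum_(i < 6) g x s`_i *: s`_i.
Proof.
move=> dimV on x.
have gsum k (j : 'I_6) : g (\sum_(i < 6) k i *: s`_i) s`_j = k j.
  rewrite dotC dot_sumr (bigD1 j) //= big1 => [|i /negPf nij].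
    by rewrite dotZr on eqxx mulr1 addr0.
  by rewrite dotZr on eq_sym nij mulr0.
have s_free : free s.
  by apply/freeP => k k0 j; rewrite -(gsum k j) k0 dot0l.
have s_basis : basis_of fullv s.
  by rewrite basisEfree s_free size_tuple dimV leqnn andbT; exact: subvf.
rewrite [LHS](coord_basis s_basis) ?memvf //; apply: eq_bigr => i _.
by rewrite {2}(coord_basis s_basis (memvf x)) gsum.
Qed.

End Euclidean.

(** * Trace zero on a line *)

Section Quotient.
Variables (R : realType) (V : vectType R).

(** On a line a scalable map is multiplication by a scalar, and that scalar is the trace. *)
Lemma quot_trace_line (U : {vspace V}) (f : V -> V) :
  scalable f -> \dim U = 1%N -> (forall u, u \in U -> f u \in U) ->
  quot_trace U 0 f = 0 -> forall u, u \in U -> f u = 0.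
Proof.
move=> fZ dimU fU.
have U0 : (U :\: 0 = U)%VS.
  by rewrite -[RHS](addv0 U) -addv_diff addv0.
have -> : quot_trace U 0 f =
    \sum_(i < \dim U) coord (vbasis U) i (f (vbasis U)`_i).
  rewrite /quot_trace; have pi1 u : u \in U -> addv_pi1 U 0 u = u.
    by move=> uU; rewrite /addv_pi1 U0 daddv_pi_id // capv0.
  move: pi1; rewrite /addv_pi1; move: (daddv_pi _ _) => h; rewrite U0 => hE.
  apply: eq_bigr => i _; rewrite hE // fU // vbasis_mem //.
  by rewrite mem_nth ?size_tuple.
have [v0 [v0U Uv0]] :
    exists v0, v0 \in U /\ forall u, u \in U -> exists k, u = k *: v0.
  exists (vbasis U)`_0; split.
    by rewrite vbasis_mem // mem_nth // size_tuple dimU.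
  move=> u /coord_vbasis ->; move: (vbasis U); rewrite dimU => X.
  by rewrite big_ord1; eexists.
have [k fv0] := Uv0 _ (fU _ v0U).
have fE u : u \in U -> f u = k *: u.
  by move=> /Uv0[k' ->]; rewrite fZ fv0 !scalerA mulrC.
move=> tr0 u /fE ->; have: k = 0; last by move->; rewrite scale0r.
rewrite -tr0 (eq_bigr (fun=> k)); first by rewrite sumr_const card_ord dimU.
move=> i _; rewrite fE; last by rewrite vbasis_mem // mem_nth ?size_tuple.
by rewrite linearZ /= (coord_free _ _ (basis_free (vbasisP U))) eqxx mulr1.
Qed.

End Quotient.

(** * Centrality of the derived algebra of the nilradical *)

Section Nilradical.
Variables (R : realType) (V : vectType R) (br : {bilinear V -> V -> V}).
Variable n : {vspace V}.
Hypotheses (lie : is_lie_bracket br) (nI : is_ideal br n).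

Lemma ideal_br x y : y \in n -> br x y \in n.
Proof. by move=> yn; apply: (lie_prod_subP _ _ _ _ nI); rewrite ?memvf. Qed.

Lemma br_ideal x y : y \in n -> br y x \in n.
Proof. by move=> yn; rewrite (brC lie) rpredN ideal_br. Qed.

Lemma lcs1_br_ideal x y : y \in lcs br n 1 -> br x y \in lcs br n 1.
Proof.
rewrite /lcs /=; set D := lie_prod br n n => yD.
(* The preimage of [D] under the adjoint action of [x] is a subspace, so by the Jacobi identity it
   is enough to test brackets of elements of the ideal [n]. *)
have /subvP sub : (D <= linfun (br x) @^-1: D)%VS.
  apply/lie_prod_subP => u w un wn; rewrite -memv_preim lfunE /=.
  have /eqP := lie.2 x u w; rewrite -addrA addr_eq0 => /eqP ->.
  by rewrite rpredN; apply: rpredD; apply: mem_lie_prod => //;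
    [exact: br_ideal | exact: ideal_br].
by have := sub y yD; rewrite -memv_preim lfunE.
Qed.

Hypotheses (n_nil : is_nilpotent br n) (dim1 : \dim (lcs br n 1) = 1%N).

Lemma lcs1_sub : (lcs br n 1 <= n)%VS.
Proof.
apply/lie_prod_subP => u w _; exact: ideal_br.
Qed.

(** Otherwise the second term would equal the first by dimension and the lower central series would
    be stationary and nonzero, contrary to nilpotency. *)
Lemma lcs2_eq0 : lcs br n 2 = 0%VS.
Proof.
have sub21 : (lcs br n 2 <= lcs br n 1)%VS.
  by apply/lie_prod_subP => u w un /(subvP lcs1_sub) wn; exact: mem_lie_prod.
apply/eqP; rewrite -dimv_eq0; apply: contraT => nz.
have e21 : lcs br n 2 = lcs br n 1 by apply/eqP; rewrite eqEdim sub21 dim1 lt0n.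
have lcsS l : lcs br n l.+1 = lcs br n 1.
  elim: l => // l IHl; rewrite -[RHS]e21.
  exact: (congr1 (lie_prod br n) IHl).
case: n_nil => -[n0|l]; last first.
  by rewrite lcsS => l0; move: dim1; rewrite l0 dimv0.
by have := dimvS lcs1_sub; rewrite dim1 [n]n0 dimv0.
Qed.

Hypothesis unimod : strongly_unimodular br n.

(** Since the next term of the series is zero, strong unimodularity at [l = 1] is a trace condition
    on the line itself. *)
Lemma lcs1_central x y : y \in lcs br n 1 -> br x y = 0.
Proof.
have := unimod x 1; rewrite lcs2_eq0 => tr0.
apply: (quot_trace_line _ dim1 (lcs1_br_ideal x) tr0) => k u; exact: brZr.
Qed.

End Nilradical.

Lemma gk_torsion (R : realType) (V : vectType R) (br : {bilinear V -> V -> V})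
    (Jp Jm : 'End(V)) (g : {dot V for idfun}) :
  is_lie_bracket br -> generalized_kahler_structure br Jp Jm g ->
  (forall x y z, torsion g br Jp x y z + torsion g br Jm x y z = 0) /\
  (forall w x y z,
    - torsion g br Jp (br w x) y z + torsion g br Jp (br w y) x z
    - torsion g br Jp (br x y) w z - torsion g br Jp (br w z) x y
    + torsion g br Jp (br x z) w y - torsion g br Jp (br y z) w x = 0).
Proof.
move=> lie [hp hm ddc _ dcpm]; split=> [x y z|w x y z].
  apply: (@complexI R); have := dcpm (args3 x y z).
  by rewrite !dc_fundamental // => h; rewrite rmorphD /= h.
apply: (@complexI R); have := ddc (args4 w x y z).
rewrite ce_d3E !dc_fundamental //.
by rewrite !(rmorphD, rmorphN) => ->.
Qed.

(** * Construction of the adapted basis *)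

Unset Implicit Arguments.
Set Strict Implicit.

Theorem proposition8p2 (R : realType) (V : vectType R)
    (br : {bilinear V -> V -> V}) (n : {vspace V})
    (lie_br : is_lie_bracket br)
    (dim6 : \dim {:V} = 6%N)
    (nonKahler : ~ exists (J : 'End(V)) (g : {dot V for idfun}),
                     kahler_structure br J g)
    (almost_nilp : almost_nilpotent br n)
    (strongly_unimod : strongly_unimodular br n)
    (dim_n1 : \dim (lcs br n 1) = 1%N) :
  ~ exists (Jp Jm : 'End(V)) (g : {dot V for idfun}),
      [/\ generalized_kahler_structure br Jp Jm g,
          (Jp @: lcs br n 1 <= n)%VS &
          lie_prod br (k3 br n Jp g) (k3 br n Jp g) <> 0%VS].
Proof.
case=> J [I [g [gk Jn1 k3_nab]]].
have [hJ hI _ _ _] := gk.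
have [torsJI dtors] := gk_torsion lie_br gk.
have [_ [nI n_nil _] codim1] := almost_nilp.
have JJ := herm_JJ hJ; have gJJ := dot_JJ hJ.
have gJl : forall x y, g (J x) y = - g x (J y) := dot_Jl hJ.
have gJxx x : g x (J x) = 0.
  by have := gJl x x; rewrite (dotC g (J x)); lra.
have central := lcs1_central lie_br nI n_nil dim_n1 strongly_unimod.
have n1_sub := lcs1_sub nI.
have [e1 e1n1 g11] : exists2 e1, e1 \in lcs br n 1 & g e1 e1 = 1.
  have [|k gk1] := @unit_multiple _ _ g (vpick (lcs br n 1)).
    by rewrite vpick0 -dimv_eq0 dim_n1.
  by exists (k *: vpick (lcs br n 1)); rewrite // memvZ // memv_pick.
have e1_neq0 : e1 != 0.
  by apply: contra_eq_neq g11 => ->; rewrite dot0l eq_sym oner_eq0.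
have n1E x : x \in lcs br n 1 -> x = g x e1 *: e1.
  have -> : lcs br n 1 = <[e1]>%VS.
    by apply/esym/eqP; rewrite eqEdim -memvE e1n1 dim_vline e1_neq0 dim_n1.
  by case/vlineP => k ->; rewrite dotZl g11 mulr1.
have k2P x : x \in k2 br n g -> g x e1 = 0 /\ x \in n.
  by rewrite memv_cap => /andP[/mem_orthovP xo xn]; split=> //; exact: xo.
have k3P x : x \in k3 br n J g ->
    [/\ g x e1 = 0, x \in n, g (J x) e1 = 0 & J x \in n].
  rewrite memv_cap => /andP[/k2P[xe1 xn]] /memv_imgP[y /k2P[ye1 yn] xE].
  by split=> //; rewrite xE JJ ?dotNl ?ye1 ?oppr0 // rpredN.
have [x [y [xk3 yk3 brxy]]] :
    exists x y, [/\ x \in k3 br n J g, y \in k3 br n J g & br x y != 0].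
  apply: contra_notP k3_nab => no; apply/eqP; rewrite -subv0.
  apply/lie_prod_subP => x y xk3 yk3; rewrite memv0; apply/negPn/negP => xy.
  by apply: no; exists x, y.
have x_neq0 : x != 0 by apply: contraNneq brxy => ->; rewrite br0l.
have [k gk3] := unit_multiple g x_neq0; pose e3 := k *: x.
have e3k3 : e3 \in k3 br n J g by rewrite memvZ.
have g33 : g e3 e3 = 1 := gk3.
have xE : x = k^-1 *: e3.
  rewrite scalerA mulVf ?scale1r //; apply: contra_eq_neq gk3 => ->.
  by rewrite scale0r dot0l eq_sym oner_eq0.
clearbody e3; rewrite xE brZl in brxy.
have [g31 e3n g41 e4n] := k3P _ e3k3.
have [|w w_neq0 wn] := @orthov_neq0 _ _ g n.
  by rewrite -codim1.
have [k' gk6] := unit_multiple g w_neq0; pose e6 := k' *: w.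
have g66 : g e6 e6 = 1 := gk6.
have n6 z : z \in n -> g z e6 = 0 by move=> zn; rewrite dotC dotZl wn ?mulr0.
clearbody e6.
have e1n := subvP n1_sub _ e1n1.
have e2n : J e1 \in n by apply: (subvP Jn1); exact: memv_img.
(* [n] is the whole hyperplane orthogonal to [e6]: a further orthogonal vector would, together with
   [n], span a space containing [e6], which would then be orthogonal to itself. *)
have nP z : g z e6 = 0 -> z \in n.
  move=> z6; apply: contraT => zn.
  have full : (n + <[z]> = fullv)%VS.
    apply/eqP; rewrite eqEdim subvf -codim1 ltnNge; apply: contra zn => le.
    have /eqP -> : n == (n + <[z]>)%VS by rewrite eqEdim addvSl.
    by rewrite memvE addvSr.
  have : e6 \in (n + <[z]>)%VS by rewrite full memvf.
  case/memv_addP => u un [v /vlineP[l ->] e6E].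
  have := g66; rewrite {1}e6E dotDl n6 // dotZl z6 mulr0 addr0 => /esym/eqP.
  by rewrite oner_eq0.
pose e := [tuple e1; J e1; e3; J e3; J e6; e6].
have gram (i j : nat) : (i < 6)%N -> (j < 6)%N -> g e`_i e`_j = (i == j)%:R.
  have g36 := n6 _ e3n; have g46 := n6 _ e4n; have g26 := n6 _ e2n.
  have g16 := n6 _ e1n.
  have swap a b r : g a b = r -> g b a = r by move=> <-; exact: dotC.
  have g14 : g e1 (J e3) = 0 by exact: swap g41.
  have g15 : g e1 (J e6) = 0 by rewrite -[LHS]opprK -gJl g26 oppr0.
  have g35 : g e3 (J e6) = 0 by rewrite -[LHS]opprK -gJl n6 ?oppr0.
  (* The upper triangle of the Gram matrix; the remaining entries follow by symmetry. *)
  have half (r l : nat) : (r <= l)%N -> (l < 6)%N -> g e`_r e`_l = (r == l)%:R.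
    case: l => [|[|[|[|[|[|//]]]]]]; case: r => [|[|[|[|[|[|//]]]]]] // _ _ /=;
    rewrite ?gJJ ?gJxx ?g11 ?g33 ?g66 ?(swap _ _ _ g31) ?g14 ?g15 ?g35 ?g16
      ?g36 ?g46 ?g26 // ?gJl ?gJxx ?g14 ?g15 ?g35 ?oppr0 //.
  move=> i6 j6; case: (leqP i j) => [ij|/ltnW ji]; first exact: half.
  by rewrite dotC half // eq_sym.
have complete := orthonormal_decomp dim6
  (fun i j : 'I_6 => gram i j (ltn_ord i) (ltn_ord j)).
have nrest z : z - g z e6 *: e6 \in n.
  by apply: nP; rewrite dotDl dotNl dotZl g66 mulr1 subrr.
(* Modulo the ideal [n] both arguments are multiples of [e6], whose bracket with itself is zero. *)
have im6 u v : g (br u v) e6 = 0.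
  apply: n6; rewrite -[u](subrK (g u e6 *: e6)) brDl rpredD //.
    exact: br_ideal.
  rewrite -[v](subrK (g v e6 *: e6)) brDr rpredD //; first exact: ideal_br.
  by rewrite brZl brZr lie_br.1 !scaler0 mem0v.
apply: (no_adapted_basis lie_br hJ hI torsJI dtors (erefl _) (erefl _)
  (erefl _) gram complete) => //.
- by move=> u; rewrite (brC lie_br) central ?oppr0.
- by move=> u v u6 v6; apply: n1E; apply: mem_lie_prod; exact: nP.
(* The components of [y] along the other four basis vectors vanish, so [y] is a combination of [e3]
   and [J e3]; if these commuted, [e3] would commute with [y]. *)
apply: contraNneq brxy => b34.
have [g_y1 yn g_Jy1 Jyn] := k3P _ yk3.
have := complete y; rewrite !big_ord_recl big_ord0 /=.
have -> : g y (J e1) = 0 by rewrite dotC gJl dotC g_Jy1 oppr0.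
have -> : g y (J e6) = 0 by rewrite dotC gJl dotC n6 ?oppr0.
rewrite g_y1 n6 // !scale0r !addr0 !add0r => ->.
by rewrite brDr !brZr lie_br.1 b34 !scaler0 addr0 scaler0.
Qed.
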